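(* Suppose that $c^{(i)},d^{(i)}$ are non-negative for $i\in\{1,2\}$. Suppose that SDA with $\lambda=0$ terminates in $t_{SDA}$ iterations. Let $$\phi=\max_{i\in\{1,2\},\,(x^{(i)},y^{(i)})\in\mathcal{X}^{(i)}}\big|\langle c^{(i)},x^{(i)}\rangle+\langle d^{(i)},y^{(i)}\rangle\big|.$$ Then, for every $\epsilon>0$, there exists a sub-gradient algorithm that solves the V-Lagrangian dual problem $\max_{\lambda,\mu}L^V(\lambda,\mu)$ to $\epsilon$-optimality (additive error) within $$O\Big(\Big(\frac{\sqrt{n}\,\phi}{\epsilon}\Big)^2\Big)\cdot t_{SDA}$$ iterations, where the constant in $O(\cdot)$ is absolute.
   Context: Two-block problem. For $i\in\{1,2\}$ let $$\mathcal{X}^{(i)}=\{(x^{(i)},y^{(i)}): A^{(i)}x^{(i)}+B^{(i)}y^{(i)}\le b^{(i)},\ y^{(i)}\ge 0 \text{ mixed-integer},\ x^{(i)}\in\{0,1\}^n\},$$ where ''mixed-integer'' means that a prescribed subset of the coordinates of $y^{(i)}$ is required to be integer, and all data, including objective vectors $c^{(i)},d^{(i)}$, are rational. The problem is $$\min\Big\{\sum_{i\in\{1,2\}}\langle c^{(i)},x^{(i)}\rangle+\langle d^{(i)},y^{(i)}\rangle:\ (x^{(i)},y^{(i)})\in\mathcal{X}^{(i)},\ i\in\{1,2\},\ x^{(1)}=x^{(2)}\Big\},$$ assumed feasible, and the maximum defining $\phi$ is assumed to exist (finite). V-Lagrangian dual. For $v\in\{0,1\}^n$ put $\sigma_{v_j}(u)=u$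 if $v_j=1$ and $\sigma_{v_j}(u)=1-u$ if $v_j=0$. Let $$\mathcal{X}^{(i)}_V=\Big\{(x^{(i)},y^{(i)},w^{(i)}):(x^{(i)},y^{(i)})\in\mathcal{X}^{(i)},\ w^{(i)}_v=\prod_{s\in[n]}\sigma_{v_s}(x^{(i)}_s)\ \ \forall v\in\{0,1\}^n\Big\},$$ and for $\lambda\in\mathbb{R}^n$, $\mu\in\mathbb{R}^{\{0,1\}^n}$ let $L^V(\lambda,\mu)$ be the minimum of $\sum_{i}(\langle c^{(i)},x^{(i)}\rangle+\langle d^{(i)},y^{(i)}\rangle)+\langle\lambda,x^{(1)}-x^{(2)}\rangle+\langle\mu,w^{(1)}-w^{(2)}\rangle$ over $(x^{(i)},y^{(i)},w^{(i)})\in\mathcal{X}^{(i)}_V$, $i\in\{1,2\}$. $L^V$ is concave. Sub-gradient algorithm: starting from an initial point $z_1$ in the space of $(\lambda,\mu)$, each iteration computes some supergradient $g_r$ of the concave function $L^V$ at $z_r$ and sets $z_{r+1}=z_r+\alpha_r g_r$ for a chosen step size $\alpha_r>0$. It solves the dual to $\epsilon$-optimality within $N$ iterations if some iterate $z_r$ among those produced satisfies $L^V(z_r)\ge\max L^V-\epsilon$. SDA (scenario decomposition algorithm) with $\lambda=0$: initialize $\mathrm{UB}=\infty$, $\mathrm{LB}=-\infty$, $\mathcal{V}=\emptyset$. While $\mathrm{UB}>\mathrm{LB}$, perform an iteration: (1) for $i\in\{1,2\}$ let $(x_*^{(i)},y_*^{(i)})$ be a minimizer, with value $p_i$, of $\langle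 c^{(i)},x^{(i)}\rangle+\langle d^{(i)},y^{(i)}\rangle$ over $(x^{(i)},y^{(i)})\in\mathcal{X}^{(i)}$ with $x^{(i)}\notin\mathcal{V}$; if one of these sub-problems is infeasible, the algorithm terminates; (2) set $\mathrm{LB}\leftarrow\max\{\mathrm{LB},p_1+p_2\}$; (3) let $h_1=\min\{\langle c^{(1)}+c^{(2)},x_*^{(1)}\rangle+\langle d^{(1)},y_*^{(1)}\rangle+\langle d^{(2)},y^{(2)}\rangle:(x_*^{(1)},y^{(2)})\in\mathcal{X}^{(2)}\}$ and $h_2=\min\{\langle c^{(1)}+c^{(2)},x_*^{(2)}\rangle+\langle d^{(1)},y^{(1)}\rangle+\langle d^{(2)},y_*^{(2)}\rangle:(x_*^{(2)},y^{(1)})\in\mathcal{X}^{(1)}\}$ ($+\infty$ if infeasible), and set $\mathrm{UB}\leftarrow\min\{\mathrm{UB},h_1,h_2\}$; (4) set $\mathcal{V}\leftarrow\mathcal{V}\cup\{x_*^{(1)},x_*^{(2)}\}$. *)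

(* Defs.v *)
From HB Require Import structures.
From mathcomp Require Import all_boot all_order all_algebra.
From mathcomp Require Import all_classical all_reals all_analysis.

Set Implicit Arguments.
Unset Strict Implicit.
Unset Printing Implicit Defensive.

Import Order.TTheory GRing.Theory Num.Theory.
Local Open Scope classical_set_scope.
Local Open Scope ring_scope.

(* {0,1}^n, used both for the binary variables x and for the index v. *)
Definition cube (n : nat) := {ffun 'I_n -> bool}.

Definition bvec (R : realType) (n : nat) (x : cube n) : 'cV[R]_n :=
  \col_s (x s)%:R.

Definition dot (R : realType) (k : nat) (u v : 'cV[R]_k) : R :=
  \sum_j u j 0 * v j 0.

Definition is_max (R : realType) (A : set R) (m : R) : Prop :=
  A m /\ ubound A m.

Record block (n : nat) := Block {
  nrow : nat;
  ncol : nat;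
  matA : 'M[rat]_(nrow, n);
  matB : 'M[rat]_(nrow, ncol);
  rhs : 'cV[rat]_nrow;
  intvars : {set 'I_ncol};
  costx : 'cV[rat]_n;
  costy : 'cV[rat]_ncol }.

(* The rational objective vectors, read in R. *)
Definition cR (R : realType) (n : nat) (P : block n) : 'cV[R]_n :=
  map_mx ratr (costx P).

Definition dR (R : realType) (n : nat) (P : block n) : 'cV[R]_(ncol P) :=
  map_mx ratr (costy P).

Definition point (R : realType) (n : nat) (P : block n) : Type :=
  (cube n * 'cV[R]_(ncol P))%type.

Definition feas (R : realType) (n : nat) (P : block n) : set (point R P) :=
  [set q | [/\ forall k, (map_mx ratr (matA P) *m bvec R q.1
                          + map_mx ratr (matB P) *m q.2) k 0
                         <= ratr (rhs P k 0),
               forall j, 0 <= q.2 j 0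
             & forall j, j \in intvars P -> q.2 j 0 \is a Num.int]].

Definition cost (R : realType) (n : nat) (P : block n) (q : point R P) : R :=
  dot (cR R P) (bvec R q.1) + dot (dR R P) q.2.

Definition nonneg_costs (n : nat) (P : block n) : Prop :=
  (forall j, 0 <= costx P j 0) /\ (forall j, 0 <= costy P j 0).

Definition feasible_problem (R : realType) (n : nat) (P1 P2 : block n) : Prop :=
  exists (q1 : point R P1) (q2 : point R P2),
    [/\ feas q1, feas q2 & q1.1 = q2.1].

Definition abs_costs (R : realType) (n : nat) (P1 P2 : block n) : set R :=
  [set `|cost q| | q in @feas R n P1] `|` [set `|cost q| | q in @feas R n P2].

Definition sigma (R : realType) (b : bool) (u : R) : R :=
  if b then u else 1 - u.

Definition pointV (R : realType) (n : nat) (P : block n) : Type :=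
  (point R P * {ffun cube n -> R})%type.

Definition feasV (R : realType) (n : nat) (P : block n) : set (pointV R P) :=
  [set q : pointV R P | feas q.1 /\
    forall v : cube n, q.2 v = \prod_s sigma (v s) (bvec R q.1.1 s 0)].

(* The space of multipliers (lambda, mu); R^o makes it a vector space over R. *)
Definition dual (R : realType) (n : nat) : Type :=
  ('cV[R^o]_n * {ffun cube n -> R^o})%type.

Definition dual_dot (R : realType) (n : nat) (g z : dual R n) : R :=
  dot g.1 z.1 + \sum_v g.2 v * z.2 v.

Definition lagrangian (R : realType) (n : nat) (P1 P2 : block n)
    (z : dual R n) (q : pointV R P1 * pointV R P2) : R :=
  cost q.1.1 + cost q.2.1
  + dot z.1 (bvec R q.1.1.1 - bvec R q.2.1.1)
  + \sum_v z.2 v * (q.1.2 v - q.2.2 v).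

(* The real infimum is the minimum whenever the latter exists, as it does for
   nonempty feasible sets (rational data) and non-negative costs. *)
Definition LV (R : realType) (n : nat) (P1 P2 : block n) (z : dual R n) : R :=
  inf [set lagrangian z q | q in @feasV R n P1 `*` @feasV R n P2].

Definition supergradient (R : realType) (n : nat) (L : dual R n -> R)
    (z g : dual R n) : Prop :=
  forall z', L z' <= L z + dual_dot g (z' - z).

(* Iterates are numbered from 0: z r is the point reached after r iterations. *)
Definition subgradient_run (R : realType) (n : nat) (L : dual R n -> R)
    (z0 : dual R n) (alpha : nat -> R) (z g : nat -> dual R n) : Prop :=
  z 0%N = z0 /\
  forall r, supergradient L (z r) (g r) /\ z r.+1 = z r + alpha r *: g r.

(* The supergradients are supplied by an arbitrary oracle, so every run from
   z0 with steps alpha has to succeed; the first conjunct excludes vacuity. *)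
Definition solves_within (R : realType) (n : nat) (L : dual R n -> R)
    (z0 : dual R n) (alpha : nat -> R) (eps N : R) : Prop :=
  (exists z g, subgradient_run L z0 alpha z g) /\
  forall z g, subgradient_run L z0 alpha z g ->
    exists (r : nat) (M : R),
      [/\ r%:R <= N, is_max (range L) M & M - eps <= L (z r)].

Record sda_state (R : realType) (n : nat) := SdaState {
  UB : \bar R;
  LB : \bar R;
  visited : {set cube n} }.

Definition sda_init (R : realType) (n : nat) : sda_state R n :=
  SdaState +oo%E -oo%E finset.set0.

Definition sub_feas (R : realType) (n : nat) (P : block n) (V : {set cube n}) :
    set (point R P) :=
  [set q | feas q /\ q.1 \notin V].

Definition sub_minimizer (R : realType) (n : nat) (P : block n)
    (V : {set cube n}) (q : point R P) : Prop :=
  sub_feas V q /\ forall q' : point R P, sub_feas V q' -> cost q <= cost q'.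

(* Value of the solution q of block P completed optimally in block Q;
   the infimum of the empty set is +oo. *)
Definition completion (R : realType) (n : nat) (P Q : block n)
    (q : point R P) : \bar R :=
  ereal_inf [set (dot (cR R P + cR R Q) (bvec R q.1)
                  + dot (dR R P) q.2 + dot (dR R Q) y)%:E
            | y in [set y : 'cV[R]_(ncol Q) | @feas R n Q (q.1, y)]].

Definition sda_step (R : realType) (n : nat) (P1 P2 : block n)
    (s s' : sda_state R n) : Prop :=
  exists (q1 : point R P1) (q2 : point R P2),
    [/\ sub_minimizer (visited s) q1, sub_minimizer (visited s) q2
      & s' = SdaState
          (Order.min (UB s) (Order.min (completion P2 q1) (completion P1 q2)))
          (Order.max (LB s) (cost q1 + cost q2)%:E)
          (visited s :|: [set q1.1; q2.1])%SET].

(* sda_run P1 P2 s t: some execution of the loop from state s, with arbitrary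
   choices of minimizers, terminates after entering the loop body t times (a
   final iteration aborted because a sub-problem is infeasible is counted). *)
Inductive sda_run (R : realType) (n : nat) (P1 P2 : block n) :
    sda_state R n -> nat -> Prop :=
| SdaClosed s of (UB s <= LB s)%E : sda_run P1 P2 s 0
| SdaAbort s of (LB s < UB s)%E
    & (@sub_feas R n P1 (visited s) = set0 \/
       @sub_feas R n P2 (visited s) = set0) :
    sda_run P1 P2 s 1
| SdaIter s s' t of (LB s < UB s)%E & sda_step P1 P2 s s'
    & sda_run P1 P2 s' t : sda_run P1 P2 s t.+1.

Definition sda_terminates_in (R : realType) (n : nat) (P1 P2 : block n)
    (t : nat) : Prop :=
  sda_run P1 P2 (sda_init R n) t.

(* Main.v *)
Require Import Defs.
From mathcomp Require Import all_boot all_order all_algebra.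
From mathcomp Require Import all_classical all_reals all_analysis.
From mathcomp Require Import ring lra.
Import Order.TTheory GRing.Theory Num.Theory.
Local Open Scope classical_set_scope.
Local Open Scope ring_scope.

(** With [f_i x] the best cost of block [i] at [x], the dual function [LV] is the
    minimum over [x1], [x2] of
    [f_1 x1 + f_2 x2 + lambda . (x1 - x2) + mu_x1 - mu_x2], so its supergradients
    have squared norm at most [3 n].  When the decomposition algorithm stops,
    either its best lower bound matches the optimal value or some block is
    infeasible outside the visited points.  In both cases the dual has an optimal
    solution with [lambda = 0] and [mu] supported on at most [2 t] visited points
    with entries at most [2 phi] in absolute value, hence at squared distance at
    most [8 t phi^2] from the origin.  The constant-step subgradient method
    started at [0] then needs at most [3 n * 8 t phi^2 / eps^2] iterations. *)

(** * Inner product on multipliers and the constant-step subgradient method *)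

Section DualSpace.
Context {R : realType} {n : nat}.
Implicit Types (a b z g : dual R n) (k : R).

Lemma dual_dotE a b :
  dual_dot a b = \sum_j a.1 j 0 * b.1 j 0 + \sum_v a.2 v * b.2 v.
Proof. by []. Qed.

Lemma dual_dotC a b : dual_dot a b = dual_dot b a.
Proof.
by rewrite !dual_dotE; congr (_ + _); apply: eq_bigr => i _; rewrite mulrC.
Qed.

Lemma dual_dotDr a b z : dual_dot a (b + z) = dual_dot a b + dual_dot a z.
Proof.
rewrite !dual_dotE addrACA -!big_split; congr (_ + _); apply: eq_bigr => i _ /=.
  by rewrite mxE mulrDr.
by rewrite ffunE mulrDr.
Qed.

Lemma dual_dotZr k a b : dual_dot a (k *: b) = k * dual_dot a b.
Proof.
rewrite !dual_dotE mulrDr !mulr_sumr; congr (_ + _); apply: eq_bigr => i _ /=.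
  by rewrite mxE mulrCA.
by rewrite ffunE mulrCA.
Qed.

Lemma dual_dotNr a b : dual_dot a (- b) = - dual_dot a b.
Proof. by rewrite -scaleN1r dual_dotZr mulN1r. Qed.

Lemma dual_dotBr a b z : dual_dot a (b - z) = dual_dot a b - dual_dot a z.
Proof. by rewrite dual_dotDr dual_dotNr. Qed.

Lemma dual_dot_ge0 a : 0 <= dual_dot a a.
Proof.
by rewrite dual_dotE addr_ge0 // sumr_ge0 // => i _; rewrite -expr2 sqr_ge0.
Qed.

Lemma dual_normD a b :
  dual_dot (a + b) (a + b) = dual_dot a a + 2 * dual_dot a b + dual_dot b b.
Proof.
by rewrite dual_dotDr !(dual_dotC (a + b)) !dual_dotDr (dual_dotC b a); ring.
Qed.

(** Young's inequality, used in place of Cauchy-Schwarz to avoid square roots. *)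
Lemma dual_amgm a b : - (dual_dot a a + dual_dot b b) <= 2 * dual_dot a b.
Proof. by have := dual_dot_ge0 (a + b); rewrite dual_normD; lra. Qed.

(** By the supergradient inequality at [zs], each step taken with gap above [eps] lowers the squared
    distance to [zs] by at least [2 s eps - s^2 G]. *)
Lemma subgradient_descent (L : dual R n -> R) z0 (s G eps : R)
    (z g : nat -> dual R n) (zs : dual R n) m :
  0 < s ->
  (forall z g, supergradient L z g -> dual_dot g g <= G) ->
  subgradient_run L z0 (fun=> s) z g ->
  (forall r, (r < m)%N -> L (z r) < L zs - eps) ->
  dual_dot (z m - zs) (z m - zs) <=
    dual_dot (z0 - zs) (z0 - zs) - m%:R * (2 * s * eps - s ^+ 2 * G).
Proof.
move=> s0 gG [zz0 zS]; elim: m => [|m IH] gap; first by rewrite zz0 mul0r subr0.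
have {}IH := IH (fun r rm => gap r (ltnW rm)).
have [sg ->] := zS m; have gm := gG _ _ sg; have {}gap := gap m (ltnSn m).
have -> : z m + s *: g m - zs = (z m - zs) + s *: g m by rewrite addrAC.
rewrite dual_normD !dual_dotZr (dual_dotC (s *: _)) dual_dotZr (dual_dotC (z m - zs) (g m)).
rewrite (dual_dotBr (g m)).
have := sg zs; rewrite (dual_dotBr (g m)) -natr1 => sgs.
set u := dual_dot (g m) (z m) - dual_dot (g m) zs.
have h1 : s * u <= s * - eps by rewrite ler_pM2l // /u; lra.
have h2 : s ^+ 2 * dual_dot (g m) (g m) <= s ^+ 2 * G.
  by rewrite ler_wpM2l // sqr_ge0.
move: IH h1 h2.
by move: (dual_dot _ _) (dual_dot (g m) (g m)) => x y; nra.
Qed.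

Lemma subgradient_convergence (L : dual R n -> R) z0 (G eps : R) (zs : dual R n) :
  0 <= G -> 0 < eps ->
  (forall z g, supergradient L z g -> dual_dot g g <= G) ->
  exists2 s : R, 0 < s & forall (z g : nat -> dual R n), subgradient_run L z0 (fun=> s) z g ->
    exists2 r : nat, r%:R <= dual_dot (z0 - zs) (z0 - zs) * G / eps ^+ 2 &
      L zs - eps <= L (z r).
Proof.
move=> G0 e0 gG; set D := dual_dot _ _.
have D0 : 0 <= D by exact: dual_dot_ge0.
suff [s s0 sP] : exists2 s : R, 0 < s &
    forall N : nat, D * G / eps ^+ 2 < N.+1%:R ->
      D - N.+1%:R * (2 * s * eps - s ^+ 2 * G) < 0.
  exists s => // z g run; have B0 : 0 <= D * G / eps ^+ 2.
    by apply: divr_ge0; [exact: mulr_ge0 | exact: sqr_ge0].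
  (* If the iterates [0] to [N] all had gap above [eps], the [N + 1] steps from them would make the
     squared distance negative. *)
  have /andP[] := truncn_itv B0; set N := Num.truncn _ => N1 N2.
  case: (pselect (exists2 r : nat, (r <= N)%N & L zs - eps <= L (z r))).
    move=> [r rN Lr]; exists r => //; apply: le_trans N1; by rewrite ler_nat.
  move=> nex; have gap r : (r < N.+1)%N -> L (z r) < L zs - eps.
    by move=> rN; rewrite ltNge; apply/negP => ?; apply: nex; exists r.
  have := subgradient_descent _ _ _ _ _ _ _ _ _ s0 gG run gap.
  have := sP N N2; have := dual_dot_ge0 (z N.+1 - zs); rewrite -/D; lra.
move: G0; rewrite le0r => /predU1P[->|G0].
  (* For [G = 0] the bound on [r] is [0], so one step must already use up [D]: its decrease is
     [2 (D + 1)]. *)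
  exists ((D + 1) / eps) => [|N _]; first by rewrite divr_gt0 // ltr_wpDl.
  have -> : 2 * ((D + 1) / eps) * eps - ((D + 1) / eps) ^+ 2 * 0 = 2 * (D + 1).
    by field; rewrite gt_eqF.
  by rewrite -natr1; have : 0 <= N%:R :> R by []; nra.
(* This [s] maximizes the decrease [2 s eps - s^2 G], with value [eps^2 / G]. *)
exists (eps / G) => [|N]; first by rewrite divr_gt0.
have -> : 2 * (eps / G) * eps - (eps / G) ^+ 2 * G = eps ^+ 2 / G.
  by field; rewrite gt_eqF.
rewrite ltr_pdivrMr ?exprn_gt0 // -ltr_pdivlMr // => h.
by rewrite subr_lt0 mulrA.
Qed.

End DualSpace.

(** * Slopes of the Lagrangian *)

Section LagrangianDual.
Context {R : realType} {n : nat}.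
Implicit Types (P : block n) (x : cube n) (z g : dual R n).

(** Each factor is the indicator that [v] and [x] agree at [s]. *)
Lemma prod_sigmaE (v x : cube n) : \prod_s sigma (v s) (bvec R x s 0) = (v == x)%:R.
Proof.
have sE (b c : bool) : sigma b (c%:R : R) = (b == c)%:R.
  by case: b; case: c; rewrite /= ?subr0 ?subrr.
case: (eqVneq v x) => [->|vx].
  by rewrite big1 // => s _; rewrite mxE sE eqxx.
have [s vs] : exists s, v s != x s.
  apply/existsP; apply: contra_neqT vx; rewrite negb_exists => /forallP vx.
  by apply/ffunP => s; apply/eqP; rewrite -[_ == _]negbK.
by rewrite (bigD1 s) //= mxE sE (negPf vs) mul0r.
Qed.

(** The gradient of the Lagrangian in [(lambda, mu)] at fixed binary parts. *)
Definition slope x1 x2 : dual R n :=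
  (bvec R x1 - bvec R x2, [ffun v => (v == x1)%:R - (v == x2)%:R]).

Lemma dual_dot_slope_mu (mu : {ffun cube n -> R^o}) x1 x2 :
  dual_dot (slope x1 x2) (0, mu) = mu x1 - mu x2.
Proof.
have pick x : \sum_v (v == x)%:R * (mu v : R) = mu x.
  rewrite (bigD1 x) //= eqxx mul1r big1 ?addr0 // => v /negPf ->.
  by rewrite mul0r.
rewrite dual_dotE big1 => [|j _]; last by rewrite [X in _ * X]mxE mulr0.
rewrite add0r -(pick x1) -(pick x2) -sumrB; apply: eq_bigr => v _.
by rewrite ffunE mulrBl.
Qed.

Lemma slope_diag x z : dual_dot (slope x x) z = 0.
Proof.
rewrite dual_dotE !big1 ?addr0 // => [v _|j _].
  by rewrite ffunE subrr mul0r.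
by rewrite !mxE subrr mul0r.
Qed.

(** The [lambda] part contributes at most [n] and the [mu] part at most [2], which is below [2 n]
    because distinct points of the cube force [n > 0]. *)
Lemma slope_norm x1 x2 : dual_dot (slope x1 x2) (slope x1 x2) <= (3 * n)%:R.
Proof.
have [->|x12] := eqVneq x1 x2.
  by rewrite slope_diag.
have n0 : (0 < n)%N.
  rewrite lt0n; apply: contra_neqN x12 => /eqP n0; apply/ffunP => -[s sn].
  by exfalso; rewrite n0 in sn.
have -> : (3 * n = n + 2 * n)%N by rewrite mulSn.
rewrite natrD dual_dotE lerD //.
  apply: le_trans (_ : \sum_(j < n) 1 <= _); last by rewrite sumr_const card_ord.
  by apply: ler_sum => j _; rewrite !mxE; case: (x1 j); case: (x2 j) => /=; lra.
have -> : \sum_v (slope x1 x2).2 v * (slope x1 x2).2 v = 2 :> R; last first.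
  by rewrite ler_nat leq_pmulr.
rewrite (bigD1 x1) // (bigD1 x2) 1?eq_sym //= !ffunE !eqxx [x2 == x1]eq_sym (negPf x12).
rewrite big1 => [|v /andP[/negPf h1 /negPf h2]]; last by rewrite ffunE h1 h2; ring.
by rewrite subr0 sub0r mulrNN !mulr1 addr0.
Qed.

Lemma cost_ge0 {P} {q : Defs.point R P} : nonneg_costs P -> feas q -> 0 <= cost q.
Proof.
move=> [cx cy] [_ y0 _].
by apply: addr_ge0; apply: sumr_ge0 => j _; rewrite mulr_ge0 // !mxE ?ler0q.
Qed.

Lemma lagrangianE {P1 P2} z (q : pointV R P1 * pointV R P2) :
  feasV q.1 -> feasV q.2 ->
  lagrangian z q =
    cost q.1.1 + cost q.2.1 + dual_dot (slope q.1.1.1 q.2.1.1) z.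
Proof.
move=> [_ w1] [_ w2]; rewrite /lagrangian -addrA dual_dotC; congr (_ + (_ + _)).
by apply: eq_bigr => v _; rewrite w1 w2 !prod_sigmaE ffunE.
Qed.

Definition extend {P} (q : Defs.point R P) : pointV R P :=
  (q, [ffun v => (v == q.1)%:R]).

Lemma feasV_extend {P} (q : Defs.point R P) : feas q -> feasV (extend q).
Proof. by move=> fq; split=> // v; rewrite prod_sigmaE ffunE. Qed.

(** * Bounds and supergradients of the dual function *)

Section Blocks.
Context {P1 P2 : block n}.
Hypotheses (feasible : feasible_problem R P1 P2)
  (nn1 : nonneg_costs P1) (nn2 : nonneg_costs P2).

Lemma LV_le z (q1 : Defs.point R P1) (q2 : Defs.point R P2) : feas q1 -> feas q2 ->
  LV P1 P2 z <= cost q1 + cost q2 + dual_dot (slope q1.1 q2.1) z.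
Proof.
move=> f1 f2; apply: ge_inf; last first.
  exists (extend q1, extend q2); first by split; apply: feasV_extend.
  by rewrite lagrangianE //; apply: feasV_extend.
(* A lower bound for the Lagrangian: costs are non-negative and [dual_amgm] controls the slope
   term. *)
exists (- ((3 * n)%:R + dual_dot z z)) => _ [q [fq1 fq2] <-].
rewrite lagrangianE //.
have := cost_ge0 nn1 fq1.1; have := cost_ge0 nn2 fq2.1.
have := dual_amgm (slope q.1.1.1 q.2.1.1) z.
have := slope_norm q.1.1.1 q.2.1.1; have := dual_dot_ge0 z.
have : 0 <= (3 * n)%:R :> R by [].
lra.
Qed.

Lemma LV_ge z (m : R) :
  (forall (q1 : Defs.point R P1) (q2 : Defs.point R P2), feas q1 -> feas q2 ->
    m <= cost q1 + cost q2 + dual_dot (slope q1.1 q2.1) z) ->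
  m <= LV P1 P2 z.
Proof.
move=> mP; apply: lb_le_inf.
  have [q1 [q2 [f1 f2 _]]] := feasible.
  exists (lagrangian z (extend q1, extend q2)); exists (extend q1, extend q2) => //.
  by split; apply: feasV_extend.
move=> _ [q [fq1 fq2] <-]; rewrite lagrangianE //; apply: mP.
  exact: fq1.1.
exact: fq2.1.
Qed.

(* Evaluating the supergradient inequality at [z - g] bounds [|g|] by the
   Lipschitz constant of [LV], which is at most the largest slope. *)
Lemma supergradient_norm z g :
  supergradient (LV P1 P2) z g -> dual_dot g g <= (3 * n)%:R.
Proof.
move=> /(_ (z - g)); rewrite [z - g - z]addrAC subrr add0r dual_dotNr => sg.
(* With the supergradient inequality this gives [|g|^2 <= (3 n + |g|^2) / 2]. *)
suff : LV P1 P2 z - ((3 * n)%:R + dual_dot g g) / 2 <= LV P1 P2 (z - g) by lra.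
apply: LV_ge => q1 q2 f1 f2; rewrite dual_dotBr.
have := LV_le z _ _ f1 f2; have := slope_norm q1.1 q2.1.
have := dual_amgm (slope q1.1 q2.1) (- g).
rewrite !dual_dotNr (dual_dotC (- g)) dual_dotNr; lra.
Qed.

(** Meaningful only under [feas_x]: [inf] of the empty set is the default [0]. *)
Definition best_cost P x : R :=
  inf [set cost q | q in [set q : Defs.point R P | feas q /\ q.1 = x]].

Definition feas_x P x : Prop := exists2 q : Defs.point R P, feas q & q.1 = x.

Lemma best_cost_le {P} (q : Defs.point R P) :
  nonneg_costs P -> feas q -> best_cost P q.1 <= cost q.
Proof.
move=> nn fq; apply: ge_inf; last by exists q.
by exists 0 => _ [q' [fq' _] <-]; exact: cost_ge0.
Qed.

Lemma best_cost_ge {P} x (m : R) : feas_x P x ->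
  (forall q : Defs.point R P, feas q -> q.1 = x -> m <= cost q) ->
  m <= best_cost P x.
Proof.
move=> [q fq qx] mP; apply: lb_le_inf; first by exists (cost q); exists q.
by move=> _ [q' [fq' q'x] <-]; exact: mP.
Qed.

(** [LV] is a minimum of finitely many affine functions, one per pair of feasible binary points; the
    slope of a piece active at [z] is a supergradient. *)
Lemma supergradient_exists z : exists g, supergradient (LV P1 P2) z g.
Proof.
pose ok (x : cube n * cube n) := `[< feas_x P1 x.1 >] && `[< feas_x P2 x.2 >].
pose val (x : cube n * cube n) :=
  best_cost P1 x.1 + best_cost P2 x.2 + dual_dot (slope x.1 x.2) z.
have [p1 [p2 [fp1 fp2 _]]] := feasible.
have ok0 : ok (p1.1, p2.1) by apply/andP; split; apply/asboolP; [exists p1|exists p2].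
case: (arg_minP val ok0) => -[x1 x2] /andP[/asboolP/= fx1 /asboolP/= fx2] xmin.
exists (slope x1 x2) => z'.
have zge : val (x1, x2) <= LV P1 P2 z.
  apply: LV_ge => q1 q2 f1 f2.
  apply: le_trans (xmin (q1.1, q2.1) _) _.
    by apply/andP; split; apply/asboolP; [exists q1|exists q2].
  by rewrite lerD2r lerD // best_cost_le.
(* Best costs are infima, so the inequality passes to them one block at a time. *)
suff : LV P1 P2 z' - dual_dot (slope x1 x2) z' - best_cost P2 x2 <= best_cost P1 x1.
  by move: zge; rewrite /val /= dual_dotBr; lra.
apply: best_cost_ge fx1 _ => q1 f1 qx1; rewrite lerBlDr -lerBlDl.
apply: best_cost_ge fx2 _ => q2 f2 qx2.
by have := LV_le z' _ _ f1 f2; rewrite qx1 qx2; lra.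
Qed.

Lemma subgradient_run_exists z0 alpha :
  exists (z g : nat -> dual R n), subgradient_run (LV P1 P2) z0 alpha z g.
Proof.
have [sg sgP] := choice supergradient_exists.
pose z := fix z r := if r is r'.+1 then z r' + alpha r' *: sg (z r') else z0.
by exists z, (sg \o z).
Qed.

(** * The primal optimal value and weak duality *)

Definition opt : R := inf [set cost q.1 + cost q.2 | q in
  [set q : Defs.point R P1 * Defs.point R P2 |
    [/\ feas q.1, feas q.2 & q.1.1 = q.2.1]]].

Lemma opt_le (q1 : Defs.point R P1) (q2 : Defs.point R P2) :
  feas q1 -> feas q2 -> q1.1 = q2.1 -> opt <= cost q1 + cost q2.
Proof.
move=> f1 f2 q12; apply: ge_inf; last by exists (q1, q2).
by exists 0 => _ [q [fq1 fq2 _] <-]; rewrite addr_ge0 // cost_ge0.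
Qed.

Lemma opt_ge (m : R) :
  (forall (q1 : Defs.point R P1) (q2 : Defs.point R P2),
    feas q1 -> feas q2 -> q1.1 = q2.1 -> m <= cost q1 + cost q2) ->
  m <= opt.
Proof.
move=> mP; apply: lb_le_inf => [|_ [q [fq1 fq2 q12] <-]]; last exact: mP.
have [q1 [q2 [f1 f2 q12]]] := feasible.
by exists (cost q1 + cost q2); exists (q1, q2).
Qed.

(** Weak duality: the multiplier term vanishes at pairs with a common [x]. *)
Lemma LV_le_opt z : LV P1 P2 z <= opt.
Proof.
apply: opt_ge => q1 q2 f1 f2 q12; apply: le_trans (LV_le z _ _ f1 f2) _.
by rewrite -q12 slope_diag addr0.
Qed.

(** * Optimal multipliers extracted from a run of the decomposition algorithm *)

Section Certificate.
Context {phi : R}.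
Hypothesis (phiP : ubound (abs_costs P1 P2) phi).

Lemma cost1_le_phi (q : Defs.point R P1) : feas q -> cost q <= phi.
Proof.
by move=> fq; apply: le_trans (ler_norm _) (phiP _ _); left; exists q.
Qed.

Lemma cost2_le_phi (q : Defs.point R P2) : feas q -> cost q <= phi.
Proof.
by move=> fq; apply: le_trans (ler_norm _) (phiP _ _); right; exists q.
Qed.

Lemma opt_itv : 0 <= opt <= 2 * phi.
Proof.
apply/andP; split.
  by apply: opt_ge => q1 q2 f1 f2 _; rewrite addr_ge0 // cost_ge0.
have [q1 [q2 [f1 f2 q12]]] := feasible; apply: le_trans (opt_le _ _ f1 f2 q12) _.
by have := cost1_le_phi _ f1; have := cost2_le_phi _ f2; lra.
Qed.

(* On [V], [mu] raises the first block to the level [p1] or, where that block is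
   infeasible, lowers the second one to [p2]; since the best costs at a common
   [v] add up to at least [opt = p1 + p2], no block falls below its level. *)
Lemma certificate (V : {set cube n}) (p1 p2 : R) :
  0 <= p1 -> 0 <= p2 -> p1 + p2 = opt ->
  (forall q1 : Defs.point R P1, sub_feas V q1 -> p1 <= cost q1) ->
  (forall q2 : Defs.point R P2, sub_feas V q2 -> p2 <= cost q2) ->
  exists2 zs, LV P1 P2 zs = opt & dual_dot zs zs <= 4 * phi ^+ 2 * #|V|%:R.
Proof.
move=> p10 p20 pE h1 h2.
pose mu : {ffun cube n -> R^o} := [ffun v => if v \in V then
  if `[< feas_x P1 v >] then p1 - best_cost P1 v
  else if `[< feas_x P2 v >] then best_cost P2 v - p2 else 0 else 0].
have mu1 (q : Defs.point R P1) : feas q -> p1 <= cost q + mu q.1.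
  move=> fq; rewrite ffunE; case: ifPn => qV; last by rewrite addr0 h1.
  rewrite asboolT; last by exists q.
  by have := best_cost_le _ nn1 fq; lra.
have mu2 (q : Defs.point R P2) : feas q -> p2 <= cost q - mu q.1.
  move=> fq; rewrite ffunE; case: ifPn => qV; last by rewrite subr0 h2.
  case: asboolP => [fx1|_]; last first.
    rewrite asboolT; last by exists q.
    by have := best_cost_le _ nn2 fq; lra.
  suff : opt - cost q <= best_cost P1 q.1 by lra.
  apply: best_cost_ge fx1 _ => q1 f1 q1x.
  by have := opt_le _ _ f1 fq q1x; lra.
(* Levels lie in [[0, 2 phi]] and best costs in [[0, phi]], so their differences are at most [2 phi]
   in absolute value. *)
have muE v : mu v * mu v <= if v \in V then 4 * phi ^+ 2 else 0.
  rewrite ffunE; case: ifPn => vV; last by rewrite mul0r.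
  have /andP[_ optphi] := opt_itv.
  case: asboolP => [fx|_].
    have b0 : 0 <= best_cost P1 v.
      by apply: best_cost_ge fx _ => q fq _; exact: cost_ge0.
    have bphi : best_cost P1 v <= phi.
      case: fx => q fq <-.
      exact: le_trans (best_cost_le _ nn1 fq) (cost1_le_phi _ fq).
    by nra.
  case: asboolP => [fx|_]; last by rewrite mul0r mulr_ge0 // sqr_ge0.
  have b0 : 0 <= best_cost P2 v.
    by apply: best_cost_ge fx _ => q fq _; exact: cost_ge0.
  have bphi : best_cost P2 v <= phi.
    case: fx => q fq <-.
    exact: le_trans (best_cost_le _ nn2 fq) (cost2_le_phi _ fq).
  by nra.
exists (0, mu).
  apply/eqP; rewrite eq_le LV_le_opt /=; apply: LV_ge => q1 q2 f1 f2.
  by rewrite dual_dot_slope_mu; have := mu1 _ f1; have := mu2 _ f2; lra.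
rewrite dual_dotE big1 ?add0r => [|j _]; last by rewrite !mxE mulr0.
apply: le_trans (ler_sum _ (fun v _ => muE v)) _.
by rewrite -big_mkcond sumr_const mulr_natr.
Qed.

(** A completed point is feasible for the coupled problem, so [UB] never drops below [opt], and
    stopping with [UB <= LB] forces [opt <= LB]. *)
Lemma opt_le_completion1 (q : Defs.point R P1) :
  feas q -> (opt%:E <= completion P2 q)%E.
Proof.
move=> fq; apply: le_ereal_inf_tmp => _ [y fy <-]; rewrite lee_fin.
apply: le_trans (opt_le _ (q.1, y) fq fy _) _ => //.
rewrite /cost /=; suff : dot (cR R P1) (bvec R q.1) + dot (cR R P2) (bvec R q.1)
  = dot (cR R P1 + cR R P2) (bvec R q.1) by lra.
by rewrite /dot -big_split; apply: eq_bigr => j _; rewrite [X in _ = X * _]mxE mulrDl.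
Qed.

Lemma opt_le_completion2 (q : Defs.point R P2) :
  feas q -> (opt%:E <= completion P1 q)%E.
Proof.
move=> fq; apply: le_ereal_inf_tmp => _ [y fy <-]; rewrite lee_fin.
apply: le_trans (opt_le (q.1, y) _ fy fq _) _ => //.
rewrite /cost /=; suff : dot (cR R P1) (bvec R q.1) + dot (cR R P2) (bvec R q.1)
  = dot (cR R P2 + cR R P1) (bvec R q.1) by lra.
by rewrite addrC /dot -big_split; apply: eq_bigr => j _; rewrite [X in _ = X * _]mxE mulrDl.
Qed.

(** Induction on the run, with [k] counting the iterations already done. The invariant on [LB]
    remembers the excluded set [V] of the iteration that produced it. *)
Lemma sda_certificate (s : sda_state R n) (t k : nat) :
  sda_run P1 P2 s t ->
  (opt%:E <= UB s)%E -> (#|visited s| <= 2 * k)%N ->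
  LB s = -oo%E \/ (exists (V : {set cube n}) q1 q2, [/\ (#|V| <= 2 * k)%N,
    @sub_minimizer R n P1 V q1, @sub_minimizer R n P2 V q2
    & LB s = (cost q1 + cost q2)%:E]) ->
  exists2 zs, LV P1 P2 zs = opt &
    dual_dot zs zs <= 4 * phi ^+ 2 * (2 * (k + t))%:R.
Proof.
move=> run; elim: run k => {s t} [s ULs|s _ abort|s s' t _ step _ IH] k ub card_s lb.
- case: lb => [LBE|].
    by have := le_trans ub ULs; rewrite LBE.
  move=> [V [q1 [q2 [cardV [[f1 _] min1] [[f2 _] min2] LBE]]]].
  have := le_trans ub ULs; rewrite LBE lee_fin => optle.
  have c1 := cost_ge0 nn1 f1; have c2 := cost_ge0 nn2 f2.
  have /andP[opt0 _] := opt_itv.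
  have [zs zsE zsn] : exists2 zs, LV P1 P2 zs = opt &
      dual_dot zs zs <= 4 * phi ^+ 2 * #|V|%:R.
    (* Only [opt <= LB] is known, while the levels must add up to exactly [opt]; lowering them keeps
       them valid outside [V]. *)
    pose p1 := Num.min (cost q1) opt.
    have p1le : p1 <= cost q1 /\ p1 <= opt.
      by rewrite /p1; split; rewrite ge_min lexx ?orbT.
    have p1ge : 0 <= p1 by rewrite le_min c1.
    have p2le : opt - p1 <= cost q2 by rewrite /p1 minEle; case: ifP => _; lra.
    apply: (certificate V p1 (opt - p1)) => //; first by lra.
    + by rewrite addrC subrK.
    + by move=> q /min1; apply: le_trans; case: p1le.
    + by move=> q /min2; apply: le_trans.
  exists zs => //; apply: le_trans zsn _; apply: ler_wpM2l.
    by rewrite mulr_ge0 // sqr_ge0.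
  by rewrite ler_nat addn0.
- have /andP[opt0 _] := opt_itv.
  have [zs zsE zsn] : exists2 zs, LV P1 P2 zs = opt &
      dual_dot zs zs <= 4 * phi ^+ 2 * #|visited s|%:R.
    (* The block with no point left meets any level vacuously and takes all of [opt]; the other
       takes [0], valid by non-negativity. *)
    case: abort => empty.
      apply: (certificate (visited s) opt 0) => //; first by rewrite addr0.
        by move=> q fq; exfalso; rewrite empty in fq.
      by move=> q [fq _]; exact: cost_ge0.
    apply: (certificate (visited s) 0 opt) => //; first by rewrite add0r.
      by move=> q [fq _]; exact: cost_ge0.
    by move=> q fq; exfalso; rewrite empty in fq.
  exists zs => //; apply: le_trans zsn _; apply: ler_wpM2l.
    by rewrite mulr_ge0 // sqr_ge0.
  by rewrite ler_nat (leq_trans card_s) // leq_mul2l leq_addr.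
- have [q1 [q2 [m1 m2 s'E]]] := step; rewrite addnS -addSn.
  have le2k : (2 * k <= 2 * k.+1)%N by rewrite leq_mul2l leqnSn.
  apply: IH; rewrite {}s'E /=.
  + by rewrite !le_min ub opt_le_completion1 ?opt_le_completion2 //;
      [case: m2; case | case: m1; case].
  + rewrite mulnS addnC; apply: leq_trans (leq_card_setU _ _) _.
    by rewrite leq_add // cards2; case: eqP.
  (* The new [LB] comes either from the current minimizers, with [V] the set visited before this
     step, or from the earlier witness. *)
  + rewrite maxEle; case: ifP => _.
      by right; exists (visited s), q1, q2; split=> //; exact: leq_trans le2k.
    case: lb => [->|[V [r1 [r2 [cV mr1 mr2 ->]]]]]; first by left.
    by right; exists V, r1, r2; split=> //; exact: leq_trans le2k.
Qed.

End Certificate.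
End Blocks.
End LagrangianDual.

(** * The iteration bound *)

Theorem proposition6 (R : realType) :
  exists C : R, 0 < C /\
  forall n : nat, exists z0 : dual R n,
  forall (P1 P2 : block n) (phi : R) (t : nat),
    feasible_problem R P1 P2 ->
    nonneg_costs P1 -> nonneg_costs P2 ->
    is_max (abs_costs P1 P2) phi ->
    sda_terminates_in R P1 P2 t ->
  forall eps : R, 0 < eps ->
  exists alpha : nat -> R, (forall r, 0 < alpha r) /\
    solves_within (LV P1 P2) z0 alpha eps
      (C * (Num.sqrt n%:R * phi / eps) ^+ 2 * t%:R).
Proof.
(* [24 = 3 * 8]: squared supergradient norms are at most [3 n], and the squared distance from [0] to
   [zs] is at most [8 t phi^2]. *)
exists 24; split=> // n; exists 0 => P1 P2 phi t feasible nn1 nn2 [_ phiP] run eps e0.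
have [zs zsE zsn] : exists2 zs, LV P1 P2 zs = opt (P1 := P1) (P2 := P2) &
    dual_dot zs zs <= 4 * phi ^+ 2 * (2 * (0 + t))%:R.
  apply: (sda_certificate feasible nn1 nn2 phiP _ _ 0%N run) => /=.
  - by rewrite leey.
  - by rewrite cards0.
  - by left.
have [s s0 sP] := subgradient_convergence (LV P1 P2) 0 (3 * n)%:R eps zs
  (ler0n _ _) e0 (supergradient_norm feasible nn1 nn2).
exists (fun=> s); split=> //; split; first exact: subgradient_run_exists.
move=> z g /sP[r rN zr]; exists r, (LV P1 P2 zs); split=> //; last first.
  by split; [exists zs | move=> _ [z' _ <-]; rewrite zsE; exact: LV_le_opt].
apply: le_trans rN _; rewrite !expr_div_n exprMn sqr_sqrtr //.
rewrite sub0r dual_dotNr dual_dotC dual_dotNr opprK.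
rewrite (mulrA 24) [leRHS]mulrAC ler_pM2r ?invr_gt0 ?exprn_gt0 //.
apply: le_trans (ler_wpM2r (ler0n _ _) zsn) _.
by rewrite add0n !natrM; lra.
Qed.
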